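(* Let $N \ge 1$ and let $G$ be a multiplicative subgroup of $S^1$. Then there is a natural stratification of the set of $N\times N$ complex matrices, namely the disjoint union \[ \mathbb{C}^{N \times N} = \bigsqcup_{\pi \in \Pi_N} \mathcal{S}^G_\pi , \] and, for every $\pi \in \Pi_N$, the stratum $\mathcal{S}^G_\pi$ has closure \[ \overline{\mathcal{S}^G_\pi} = \bigsqcup_{\pi' \prec \pi} \mathcal{S}^G_{\pi'} \] when $\mathbb{C}^{N\times N}$ is equipped with its usual topology.
   Context: $S^1$ is the unit circle in $\mathbb{C}$. $\Pi_N$ is the set of all partitions of $\{1,\ldots,N\}$, partially ordered by $\pi' \prec \pi$ if and only if $\pi$ is a refinement of $\pi'$ (with $\pi \prec \pi$ allowed). For $A \in \mathbb{C}^{N\times N}$ and a multiplicative group $G \subset S^1$, $\pi^G(A) \in \Pi_N$ denotes the unique minimal (coarsest) partition $\{I_1,\ldots,I_m\}$ of $\{1,\ldots,N\}$ such that, for all $i,j \in \{1,\ldots,m\}$, the entries of the block submatrix $A_{I_i \times I_j}$ lie in a single $G$-orbit, where the $G$-orbit of $a\in\mathbb{C}$ is $\{ga : g \in G\}$. For $\pi \in \Pi_N$, the stratum is $\mathcal{S}^G_\pi := \{A \in \mathbb{C}^{N \times N} : \pi^G(A) = \pi\}$.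
   Formalization: The closure formula is stated only for G closed in S^1; for non-closed G it fails when N ≥ 2 (e.g. G all roots of unity, N = 2, π = {{1,2}}: limits of matrices with entries in one orbit can leave the orbit). The disjoint union holds for every G. *)

(* Defs.v *)
From HB Require Import structures.
From mathcomp Require Import all_boot all_order all_algebra.
From mathcomp Require Import all_classical all_reals.
From mathcomp Require Import topology normedtype.
From mathcomp Require Export complex.

Set Implicit Arguments.
Unset Strict Implicit.
Unset Printing Implicit Defensive.

Import Order.TTheory GRing.Theory Num.Theory.
Import numFieldNormedType.Exports.

Local Open Scope classical_set_scope.
Local Open Scope ring_scope.

(* The name fixes the numClosedFieldType structure of R[i], from which
   MathComp-Analysis derives the norm topology on R[i] and, entrywise, the usual
   topology on 'M[Cplx R]_N. *)
Definition Cplx (R : realType) : numClosedFieldType := R[i].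

Definition unit_circle (R : realType) : set (Cplx R) := [set z | `|z| = 1].

Definition mul_subgroup (R : realType) (G : set (Cplx R)) : Prop :=
  [/\ G 1, (forall g h, G g -> G h -> G (g * h)) & (forall g, G g -> G g^-1)].

Definition orbit (R : realType) (G : set (Cplx R)) (a : Cplx R) : set (Cplx R) :=
  [set g * a | g in G].

Definition Partitions (N : nat) : set {set {set 'I_N}} :=
  [set P | finset.partition P (finset.setT : {set 'I_N})].

(* [refines P P']: P is a refinement of P'. *)
Definition refines (N : nat) (P P' : {set {set 'I_N}}) : Prop :=
  forall I : {set 'I_N}, I \in P -> exists2 J, J \in P' & I \subset J.

(* Coarser partitions are smaller. *)
Definition prec (N : nat) (P' P : {set {set 'I_N}}) : Prop := refines P P'.

Definition block_orbital (R : realType) (N : nat) (G : set (Cplx R))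
    (A : 'M[Cplx R]_N) (P : {set {set 'I_N}}) : Prop :=
  forall I J : {set 'I_N}, I \in P -> J \in P ->
    exists a : Cplx R, forall i j, i \in I -> j \in J -> orbit G a (A i j).

Definition minimal_block_orbital (R : realType) (N : nat) (G : set (Cplx R))
    (A : 'M[Cplx R]_N) : set {set {set 'I_N}} :=
  [set P | [/\ Partitions P, block_orbital G A P &
     forall Q, Partitions Q -> block_orbital G A Q -> prec Q P -> Q = P]].

(* The partition pi^G(A); by [minimal_block_orbital_unique] below, the default
   value is never used when G is a group. *)
Definition pi_part (R : realType) (N : nat) (G : set (Cplx R))
    (A : 'M[Cplx R]_N) : {set {set 'I_N}} :=
  xget (finset.set0 : {set {set 'I_N}}) (minimal_block_orbital G A).

Definition stratum (R : realType) (N : nat) (G : set (Cplx R))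
    (P : {set {set 'I_N}}) : set 'M[Cplx R]_N :=
  [set A | pi_part G A = P].

Definition is_disjoint_union (T I : Type) (X : set T) (D : set I)
    (F : I -> set T) : Prop :=
  X = \bigcup_(i in D) F i /\ trivIset D F.

Lemma partition_prec_anti (N : nat) (P Q : {set {set 'I_N}}) :
  Partitions P -> Partitions Q -> prec P Q -> prec Q P -> P = Q.
Proof.
suff H (P1 Q1 : {set {set 'I_N}}) : Partitions P1 -> Partitions Q1 ->
    prec P1 Q1 -> prec Q1 P1 -> P1 \subset Q1.
  by move=> pP pQ PQ QP; apply/eqP; rewrite finset.eqEsubset !H.
move=> /and3P[_ /finset.trivIsetP tP nP] _ PQ QP; apply/fintype.subsetP => I IP.
have [J JQ IJ] := QP I IP; have [K KP JK] := PQ J JQ.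
have [eIK|neIK] := eqVneq I K.
  suff -> : I = J by [].
  by apply/eqP; rewrite finset.eqEsubset IJ eIK JK.
have dIK := tP I K IP KP neIK.
case: (set_0Vmem I) => [I0|[i iI]]; first by rewrite I0 in IP; rewrite IP in nP.
have iK : i \in K by apply: (fintype.subsetP JK); apply: (fintype.subsetP IJ).
by move/pred0P: dIK => /(_ i) /=; rewrite iI iK.
Qed.

Section PiPart.
Variables (R : realType) (N : nat) (G : set (Cplx R)) (A : 'M[Cplx R]_N).
Hypotheses (GS : G `<=` @unit_circle R) (gG : mul_subgroup G).

Let same (a b : Cplx R) : bool := `[< orbit G a b >].

Let sameR a : same a a.
Proof. by apply/asboolP; exists 1; [case: gG|rewrite mul1r]. Qed.

Let sameC a b : same a b -> same b a.
Proof.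
move=> /asboolP[g Gg <-]; apply/asboolP; exists g^-1; first by case: gG => _ _; exact.
rewrite mulKf //; apply/eqP => g0; have := GS Gg.
by rewrite /unit_circle /= g0 normr0 => /esym/eqP; rewrite oner_eq0.
Qed.

Let sameT b a c : same a b -> same b c -> same a c.
Proof.
move=> /asboolP[g Gg <-] /asboolP[h Gh <-]; apply/asboolP; exists (h * g).
  by case: gG => _ + _; exact.
by rewrite mulrA.
Qed.

Let twin (i k : 'I_N) : bool :=
  [forall j, same (A i j) (A k j) && same (A j i) (A j k)].

Let twinE : {in finset.setT & &, equivalence_rel twin}.
Proof.
have tR i : twin i i by apply/forallP => j; rewrite !sameR.
have tC i k : twin i k -> twin k i.
  by move=> /forallP h; apply/forallP => j; case/andP: (h j) => /sameC -> /sameC ->.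
have tT k i l : twin i k -> twin k l -> twin i l.
  move=> /forallP h /forallP h'; apply/forallP => j.
  by case/andP: (h j) => a b; case/andP: (h' j) => /(sameT a) -> /(sameT b) ->.
move=> i k l _ _ _; split=> // ik; apply/idP/idP; last exact: tT.
exact/tT/tC.
Qed.

Let P0 := equivalence_partition twin (finset.setT : {set 'I_N}).

Let P0_part : Partitions P0.
Proof. exact: (equivalence_partitionP twinE). Qed.

Let P0_block (I : {set 'I_N}) i k : I \in P0 -> i \in I -> k \in I -> twin i k.
Proof.
move=> IP iI kI; rewrite -(pblock_equivalence_partition twinE) ?inE//.
case/and3P: P0_part => _ tP _.
by rewrite -/P0 (def_pblock tP IP iI).
Qed.

Let P0_orb : block_orbital G A P0.
Proof.
move=> I J IP JP.
have [->|[i0 i0I]] := set_0Vmem I; first by exists 0 => i j; rewrite inE.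
have [->|[j0 j0J]] := set_0Vmem J; first by exists 0 => i j _; rewrite inE.
exists (A i0 j0) => i j iI jJ; apply/asboolP.
have /forallP/(_ j0)/andP[h _] := P0_block IP i0I iI.
have /forallP/(_ i)/andP[_ h'] := P0_block JP j0J jJ.
exact: sameT h h'.
Qed.

Let P0_least Q : Partitions Q -> block_orbital G A Q -> prec P0 Q.
Proof.
move=> pQ oQ I IQ; case/and3P: (pQ) => /eqP cQ tQ nQ.
have [I0|[i iI]] := set_0Vmem I; first by rewrite I0 in IQ; rewrite IQ in nQ.
exists (finset.pblock P0 i).
  by rewrite finset.pblock_mem//; case/and3P: P0_part => /eqP -> _ _; rewrite inE.
apply/fintype.subsetP => k kI.
rewrite (pblock_equivalence_partition twinE) ?inE//; apply/forallP => j.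
have jJ : j \in finset.pblock Q j by rewrite finset.mem_pblock cQ inE.
have JQ : finset.pblock Q j \in Q by rewrite finset.pblock_mem// cQ inE.
have orb a b c : orbit G c a -> orbit G c b -> same a b.
  by move=> /asboolP/sameC h /asboolP h'; exact: sameT h h'.
have [c hc] := oQ I _ IQ JQ; have [d hd] := oQ _ I JQ IQ.
by rewrite (orb _ _ _ (hc i j iI jJ) (hc k j kI jJ))
           (orb _ _ _ (hd j i jJ iI) (hd j k jJ kI)).
Qed.

Lemma minimal_block_orbital_unique : exists! P, minimal_block_orbital G A P.
Proof.
exists P0; split.
  split=> // Q pQ oQ QP; apply: partition_prec_anti => //; exact: P0_least.
by move=> P [pP oP mP]; apply: mP => //; exact: P0_least.
Qed.

End PiPart.

(* Main.v *)
Require Import Defs.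
From mathcomp Require Import all_boot all_order all_algebra.
From mathcomp Require Import all_classical all_reals.
From mathcomp Require Import topology normedtype.
Import Order.TTheory GRing.Theory Num.Theory.
Import numFieldNormedType.Exports.
Local Open Scope classical_set_scope.
Local Open Scope ring_scope.

(** When G is closed, membership of A in the closure of the stratum of P means
    that P is block orbital for A ([closure_stratumE]), that is, that for all
    blocks I and J of P the entries of A over I x J lie in one G-orbit. Since
    pi^G(A) is the least partition that is block orbital for A
    ([pi_part_least]), and every refinement of a block orbital partition is
    block orbital, this says that pi^G(A) is coarser than P, which is the
    asserted description of the closure.

    Being block orbital for P is a closed condition ([closed_block_orbital]):
    it says that certain pairs of entries lie in the same orbit, and the
    relation of lying in the same orbit is closed ([orbit_cvg]). Indeed, a
    limit of pairs (a, g a) is a pair (b, c) with |b| = |c|; either both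
    vanish, or c / b is a limit of elements of the closed set G.

    Conversely, let P be block orbital for A. Increase the modulus of every
    entry of A in a diagonal block of P by the same small e > 0, without
    changing its phase. Multiplication by elements of the unit circle commutes
    with this operation, so P stays block orbital. For i and k in distinct
    blocks of P, the (i, i) entry now has modulus |A i i| + e and the (k, i)
    entry still has modulus |A k i|. These differ for all but finitely many e,
    and then i and k cannot share a block of a block orbital partition. Thus P
    is the least block orbital partition of the perturbed matrix
    ([pi_part_perturb]), which therefore lies in the stratum of P and tends to
    A with e. *)

(* The unqualified name would mean the orbit of a point under iteration. *)
Local Notation orbit := Defs.orbit.

(** * Orbits of a subgroup of the unit circle *)

Section Orbits.
Context {R : realType} {G : set (Cplx R)}.
Hypotheses (GS : G `<=` @unit_circle R) (gG : mul_subgroup G).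
Implicit Types a b c e : Cplx R.

Lemma orbit_refl a : orbit G a a.
Proof. by exists 1; [case: gG|rewrite mul1r]. Qed.

Lemma orbit_sym a b : orbit G a b -> orbit G b a.
Proof.
move=> [g Gg <-]; exists g^-1; first by case: gG => _ _; exact.
by rewrite mulKf // -normr_eq0 (GS _ Gg) oner_eq0.
Qed.

Lemma orbit_trans b a c : orbit G a b -> orbit G b c -> orbit G a c.
Proof.
move=> [g Gg <-] [h Gh <-]; exists (h * g); last by rewrite mulrA.
by case: gG => _ + _; exact.
Qed.

Lemma orbit_norm a b : orbit G a b -> `|b| = `|a|.
Proof. by move=> [g Gg <-]; rewrite normrM (GS _ Gg) mul1r. Qed.

(** When a = 0, equality of moduli already forces b = 0. Asking for b / a in G
    only when a != 0 confines the quotient to where it is continuous. *)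
Lemma orbit_of_div a b :
  `|b| = `|a| -> (a != 0 -> G (b / a)) -> orbit G a b.
Proof.
have [->|a0] := eqVneq a 0; last by move=> _ /(_ isT); exists (b / a) => //; rewrite divfK.
by rewrite normr0 => /normr0_eq0 -> _; exact: orbit_refl.
Qed.

(** Limits preserve both hypotheses of [orbit_of_div], equality of moduli
    because G lies in the unit circle and membership of the quotient because G
    is closed. *)
Lemma orbit_cvg {T : Type} {F : set_system T} {FF : ProperFilter F}
    (f g : T -> Cplx R) a b : closed G ->
  f @ F --> a -> g @ F --> b -> (\forall x \near F, orbit G (f x) (g x)) ->
  orbit G a b.
Proof.
move=> cG fa gb fg; apply: orbit_of_div.
  have nf : (fun x => `|f x|) @ F --> `|a| by exact (cvg_norm fa).
  have ng : (fun x => `|g x|) @ F --> `|b| by exact (cvg_norm gb).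
  have fgF : {near F, (fun x => `|f x|) =1 (fun x => `|g x|)}.
    by apply: filterS fg => x /orbit_norm.
  exact: norm_cvg_unique ng (cvg_trans (near_eq_cvg fgF) nf).
move=> a0; have gf : (fun x => g x / f x) @ F --> b / a by exact (cvgM gb (cvgV a0 fa)).
apply: (closed_cvg G cG _ _ gf).
have f0 : \forall x \near F, f x != 0 by exact (cvgr_neq0 a fa a0).
by apply: filterS2 f0 fg => x fx0 [h Gh <-]; rewrite mulfK.
Qed.

(** The value 1 at 0 lets [push] move zero entries as well. *)
Definition phase a : Cplx R := if a == 0 then 1 else a / `|a|.

Lemma norm_phase a : `|phase a| = 1.
Proof.
rewrite /phase; case: eqVneq => [_|a0]; first by rewrite normr1.
by rewrite normf_div normr_id divff // normr_eq0.
Qed.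

Lemma norm_mul_phase a : `|a| * phase a = a.
Proof.
rewrite /phase; case: eqVneq => [->|a0]; first by rewrite normr0 mul0r.
by rewrite mulrC divfK // normr_eq0.
Qed.

Definition push e a : Cplx R := (`|a| + e) * phase a.

Lemma norm_push e a : 0 <= e -> `|push e a| = `|a| + e.
Proof. by move=> e0; rewrite normrM norm_phase mulr1 ger0_norm // addr_ge0. Qed.

Lemma push_dist e a : 0 <= e -> `|a - push e a| = e.
Proof.
move=> e0; rewrite /push mulrDl norm_mul_phase opprD addNKr normrN normrM.
by rewrite norm_phase mulr1 ger0_norm.
Qed.

(** An element of G multiplies the phase and keeps the modulus; on zero
    entries it acts trivially, and they are all pushed to the same value e. *)
Lemma orbit_push e a b : orbit G a b -> orbit G (push e a) (push e b).
Proof.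
have [->|a0] := eqVneq a 0.
  by move=> /orbit_norm; rewrite normr0 => /normr0_eq0 ->; exact: orbit_refl.
move=> [g Gg <-]; exists g => //.
have g1 : `|g| = 1 := GS _ Gg.
have g0 : g != 0 by rewrite -normr_eq0 g1 oner_eq0.
rewrite /push /phase mulf_eq0 (negPf a0) (negPf g0) /= normrM g1 mul1r.
by rewrite mulrCA -[in RHS]mulrA.
Qed.

End Orbits.

(** * Block orbital partitions *)

Section BlockOrbital.
Context {R : realType} {N : nat} {G : set (Cplx R)}.
Hypotheses (GS : G `<=` @unit_circle R) (gG : mul_subgroup G).
Implicit Types (A : 'M[Cplx R]_N) (P Q : {set {set 'I_N}}) (I J : {set 'I_N}).

Lemma prec_refl P : prec P P.
Proof. by move=> I IP; exists I. Qed.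

Lemma prec_trans {P Q S} : prec P Q -> prec Q S -> prec P S.
Proof.
move=> PQ QS I /QS[J JQ IJ]; have [K KP JK] := PQ J JQ.
by exists K => //; exact: fintype.subset_trans IJ JK.
Qed.

(** Without the existential over a representative of the orbit, the condition
    only relates pairs of entries, which is the form that passes to limits. *)
Lemma block_orbitalP A P :
  block_orbital G A P <->
  forall I J, I \in P -> J \in P -> forall i i' j j',
    i \in I -> i' \in I -> j \in J -> j' \in J -> orbit G (A i j) (A i' j').
Proof.
split=> [oP I J IP JP i i' j j' iI i'I jJ j'J|h I J IP JP].
  have [a ha] := oP I J IP JP.
  exact: orbit_trans gG _ _ _ (orbit_sym GS gG _ _ (ha i j iI jJ)) (ha i' j' i'I j'J).
have [->|[i iI]] := set_0Vmem I; first by exists 0 => i j; rewrite inE.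
have [->|[j jJ]] := set_0Vmem J; first by exists 0 => i' j _; rewrite inE.
by exists (A i j) => i' j' i'I j'J; exact: h IP JP _ _ _ _ iI i'I jJ j'J.
Qed.

Lemma block_orbital_prec A P Q :
  prec P Q -> block_orbital G A P -> block_orbital G A Q.
Proof.
move=> PQ oP I J /PQ[I' I'P /fintype.subsetP II'] /PQ[J' J'P /fintype.subsetP JJ'].
by have [a ha] := oP I' J' I'P J'P; exists a => i j /II' iI' /JJ'; exact: ha.
Qed.

Lemma pi_partP A : minimal_block_orbital G A (pi_part G A).
Proof.
have [P [mP _]] := @minimal_block_orbital_unique R N G A GS gG.
exact: xgetI mP.
Qed.

Lemma Partitions_pi_part A : Partitions (pi_part G A).
Proof. by case: (pi_partP A). Qed.

(** By finiteness there is a minimal block orbital partition below Q, and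
    minimal block orbital partitions are unique. *)
Lemma pi_part_least A Q :
  Partitions Q -> block_orbital G A Q -> prec (pi_part G A) Q.
Proof.
move=> pQ oQ.
pose below S := [set T : {set {set 'I_N}} | `[< Partitions T /\ prec T S >]]%SET.
pose good S := `[< [/\ Partitions S, block_orbital G A S & prec S Q] >].
have goodQ : good Q by apply/asboolP; split=> //; exact: prec_refl.
(* The number of coarser partitions strictly increases along the order. *)
have [P /asboolP[pP oP PQ] leP] := arg_minnP (fun S => #|below S|) goodQ.
suff mP : minimal_block_orbital G A P.
  have [P0 [_ uP0]] := @minimal_block_orbital_unique R N G A GS gG.
  by rewrite -(uP0 _ (pi_partP A)) (uP0 _ mP).
split=> // S pS oS SP; apply: partition_prec_anti => //.
have sub : below S \subset below P.
  apply/fintype.subsetP => T; rewrite !inE => -[pT TS].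
  by split=> //; exact: prec_trans TS SP.
have goodS : good S by apply/asboolP; split=> //; exact: prec_trans SP PQ.
have /eqP/setP/(_ P) : below S == below P by rewrite eqEcard sub leP.
rewrite !finset.inE => e; suff /asboolP[] : `[< Partitions P /\ prec P S >] by [].
by rewrite e; apply/asboolP; split=> //; exact: prec_refl.
Qed.

Lemma block_orbitalE A P : Partitions P ->
  block_orbital G A P <-> prec (pi_part G A) P.
Proof.
move=> pP; split; first exact: pi_part_least.
by case: (pi_partP A) => _ oA _ /block_orbital_prec; exact.
Qed.

(** * Block orbital matrices form a closed set *)

Lemma closed_block_orbital P : closed G ->
  closed [set A | block_orbital G A P].
Proof.
move=> cG A clA; apply/block_orbitalP => I J IP JP i i' j j' iI i'I jJ j'J.
pose F := within [set B | block_orbital G B P] (nbhs A).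
have FF : ProperFilter F by exact (within_nbhs_proper clA).
have entry k l : (fun B : 'M[Cplx R]_N => B k l) @ F --> A k l.
  by exact (cvg_within_filter _ (@coord_continuous (Cplx R) N N k l A)).
apply: (orbit_cvg GS gG _ _ _ _ cG (entry i j) (entry i' j')).
have FP : F [set B | block_orbital G B P] by exact: withinT.
apply: filterS FP => B /block_orbitalP oB; exact: oB iI i'I jJ j'J.
Qed.

(** * Perturbing a block orbital matrix *)

Definition same_block P (i k : 'I_N) := finset.pblock P i == finset.pblock P k.

Definition perturb P (e : Cplx R) A : 'M[Cplx R]_N :=
  \matrix_(i, j) if same_block P i j then push e (A i j) else A i j.

Lemma perturb_block_orbital P e A : Partitions P ->
  block_orbital G A P -> block_orbital G (perturb P e A) P.
Proof.
move=> /and3P[_ tP _] /block_orbitalP oA; apply/block_orbitalP.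
move=> I J IP JP i i' j j' iI i'I jJ j'J; rewrite !mxE /same_block.
rewrite !(def_pblock tP IP iI, def_pblock tP IP i'I).
rewrite !(def_pblock tP JP jJ, def_pblock tP JP j'J).
have oij := oA I J IP JP i i' j j' iI i'I jJ j'J.
by case: ifP => // _; exact: orbit_push.
Qed.

(** If i and k lie in one block of a partition that is block orbital for the
    perturbed matrix, then its (i, i) and (k, i) entries have equal moduli.
    The excluded values of e make this impossible unless i and k already share
    a block of P, for otherwise only the (i, i) entry has been pushed. *)
Lemma pi_part_perturb P e A : Partitions P -> block_orbital G A P -> 0 <= e ->
  (forall i k, e != `|A k i| - `|A i i|) -> pi_part G (perturb P e A) = P.
Proof.
move=> pP oA e0 eN; set B := perturb P e A.
case: (pi_partP B) => pB oB _.
apply: partition_prec_anti => //.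
  by apply: pi_part_least => //; exact: perturb_block_orbital.
move: (pP) (pB) => /and3P[/eqP cP tP nP] /and3P[_ tB nB] J JB.
have [J0|[i iJ]] := set_0Vmem J; first by rewrite J0 in JB; rewrite JB in nB.
exists (finset.pblock P i); first by rewrite finset.pblock_mem // cP inE.
apply/fintype.subsetP => k kJ.
have kP : k \in finset.cover P by rewrite cP inE.
suff /eqP -> : same_block P i k by rewrite finset.mem_pblock.
apply/negPn/negP => ik.
have /block_orbitalP/(_ J J JB JB i k i i iJ kJ iJ iJ)/(orbit_norm GS) := oB.
rewrite !mxE {2}/same_block eqxx norm_push // [same_block P k i]eq_sym.
rewrite -/(same_block P i k) (negPf ik) => eki.
by have := eN i k; rewrite eki addrAC subrr add0r eqxx.
Qed.

End BlockOrbital.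

(** * The closure of a stratum *)

(** The order on the scalars is partial, so a minimum of the positive elements
    of s is not at hand; each element that falls below the current bound is
    escaped by halving it. *)
Lemma small_pos_notin (K : numFieldType) (s : seq K) (d : K) : 0 < d ->
  exists e, [/\ 0 < e, e <= d & e \notin s].
Proof.
move=> d0; suff [e [e0 ed h]] : exists e, [/\ 0 < e, e <= d &
    forall x, x \in s -> 0 < x -> ~~ (x <= e)].
  exists e; split=> //; apply/negP => es; have := h e es e0.
  by rewrite lexx.
elim: s => [|x s [e [e0 ed h]]]; first by exists d.
have [/andP[x0 xe]|nxe] := boolP ((0 < x) && (x <= e)); last first.
  exists e; split=> // y; rewrite inE => /predU1P[->|/h //] x0.
  by move: nxe; rewrite x0.
have hx : x / 2 < x by rewrite ltr_pdivrMr // ltr_pMr // ltr1n.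
exists (x / 2); split; first by rewrite divr_gt0.
  exact: le_trans (ltW hx) (le_trans xe ed).
move=> y; rewrite inE => /predU1P[-> _|ys y0].
  by apply/negP => /(lt_le_trans hx); rewrite ltxx.
by apply: contra (h y ys y0) => /le_trans; apply; exact: le_trans (ltW hx) xe.
Qed.

Lemma closure_stratumE {R : realType} {N : nat} {G : set (Cplx R)}
    (P : {set {set 'I_N}}) :
  G `<=` @unit_circle R -> mul_subgroup G -> closed G -> Partitions P ->
  closure (stratum G P) = [set A | block_orbital G A P].
Proof.
move=> GS gG cG pP; apply/seteqP; split=> [A|A /= oA].
  move=> clA; apply: (closed_block_orbital GS gG P cG).
  apply: closure_subset clA => B BP.
  by apply/block_orbitalE => //; rewrite BP; exact: prec_refl.
move=> U /nbhs_ballP[d /= d0 dU].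
(* The values of e that pi_part_perturb excludes. *)
pose s := [seq `|A p.1 p.2| - `|A p.2 p.2| | p : 'I_N * 'I_N].
have [e [e0 ed es]] : exists e, [/\ 0 < e, e <= d / 2 & e \notin s].
  by apply: small_pos_notin; rewrite divr_gt0.
exists (perturb P e A); split.
  apply: pi_part_perturb => //; first exact: ltW.
  move=> i k; apply: contraNneq es => ->.
  by apply/fintype.imageP; exists (k, i).
apply: dU; split=> // i j; rewrite -ball_normE /= !mxE.
case: ifP => _; last by rewrite subrr normr0.
rewrite push_dist ?ltW //; apply: le_lt_trans ed _.
by rewrite ltr_pdivrMr // ltr_pMr // ltr1n.
Qed.

Theorem proposition2p6 (R : realType) (N : nat) (G : set (Cplx R)) :
  (1 <= N)%N ->
  G `<=` @unit_circle R ->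
  mul_subgroup G ->
  is_disjoint_union [set: 'M[Cplx R]_N] (@Partitions N) (@stratum R N G)
  /\ (closed G ->
      forall P : {set {set 'I_N}}, Partitions P ->
        is_disjoint_union (closure (stratum G P))
          [set P' | Partitions P' /\ prec P' P] (@stratum R N G)).
Proof.
move=> _ GS gG; have trivS D : trivIset D (@stratum R N G).
  by move=> P Q _ _ [A [<- <-]].
have pi_in A := Partitions_pi_part GS gG A.
split=> [|cG P pP]; split; [|exact: trivS| |exact: trivS].
  by apply/esym/seteqP; split=> // A _; exists (pi_part G A).
rewrite closure_stratumE //; apply/seteqP; split=> [A /= AP|A [Q [_ QP] AQ]].
  by exists (pi_part G A) => //; split=> //; exact/block_orbitalE.
by apply/block_orbitalE => //; rewrite AQ.
Qed.
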